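(* For every fixed real $C>1$ there exists an integer $k_0=k_0(C)$ such that, for all integers $k\ge k_0$ and all integers $n\ge C(k+1)$, \[ \frac{\Phi(C)}{2}\cdot\frac{n}{k+1}\log\log(k+1)<M(n,k)<\frac{3}{2}\cdot\frac{n}{k+1}\log\log(k+1). \]
   Context: All graphs are finite, simple and undirected; all logarithms are natural. For a connected graph $G$, a set $D\subseteq V(G)$ is a dominating set if every vertex of $V(G)\setminus D$ has a neighbor in $D$; it is a connected dominating set if moreover the induced subgraph $G[D]$ is connected. The domination number $\gamma(G)$ (respectively the connected domination number $\gamma_c(G)$) is the minimum cardinality of a dominating set (respectively connected dominating set) of $G$. For integers $n,k$ with $n-1\ge k>1$, $M(n,k)$ denotes the maximum of $\gamma_c(G)-\gamma(G)$ over all connected graphs $G$ with $n$ vertices and minimum degree at least $k$. For real $x>1$, $\Phi(x)=\dfrac{1}{x\log\frac{x}{x-1}}$. *)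

(* Defs.v *)
From HB Require Import structures.
From mathcomp Require Import all_boot all_order all_algebra.
From mathcomp Require Import reals exp.

Set Implicit Arguments.
Unset Strict Implicit.
Unset Printing Implicit Defensive.

Import Order.TTheory GRing.Theory Num.Theory.

Section Graphs.
Variable T : finType.
Implicit Types (e : rel T) (D : {set T}).

Definition simple_graph e : bool :=
  [forall x, ~~ e x x] && [forall x, forall y, e x y == e y x].

(* The subgraph induced by D, as a relation on T without edges outside D. *)
Definition induced e D : rel T := [rel x y | [&& x \in D, y \in D & e x y]].

Definition induced_connected e D : bool :=
  [forall x in D, forall y in D, connect (induced e D) x y].

Definition connected_graph e : bool := induced_connected e [set: T].

Definition degree e (x : T) : nat := #|[set y | e x y]|.

Definition min_degree_ge e (k : nat) : bool := [forall x, k <= degree e x].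

Definition dominating e D : bool :=
  [forall x, (x \notin D) ==> [exists y in D, e x y]].

Definition connected_dominating e D : bool :=
  dominating e D && induced_connected e D.

(* In both minima the default set [set: T] is admissible: it is always
   dominating, and it is connected dominating when e is connected.  The value
   of gamma_c on a disconnected graph is meaningless. *)
Definition gamma e : nat := #|[arg min_(D < [set: T] | dominating e D) #|D|]|.

Definition gamma_c e : nat :=
  #|[arg min_(D < [set: T] | connected_dominating e D) #|D|]|.

Lemma dominatingT e : dominating e [set: T].
Proof. by apply/forallP => x; rewrite inE. Qed.

Lemma gamma_le_gamma_c e : connected_graph e -> gamma e <= gamma_c e.
Proof.
move=> ce; rewrite /gamma /gamma_c.
case: arg_minnP => [|D _ minD]; first exact: dominatingT.
case: arg_minnP => [|D' /andP[domD' _] _]; last exact: minD.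
by rewrite /connected_dominating dominatingT.
Qed.

End Graphs.

(* A graph on 'I_n is encoded by the set of its adjacent ordered pairs, which
   makes the graphs on 'I_n a finite type. *)
Definition adj n (E : {set 'I_n * 'I_n}) : rel 'I_n :=
  [rel x y | (x, y) \in E].

Definition M_graph (n k : nat) (E : {set 'I_n * 'I_n}) : bool :=
  [&& simple_graph (adj E), connected_graph (adj E) & min_degree_ge (adj E) k].

(* The truncated subtraction is exact by gamma_le_gamma_c, and the maximum is
   over a nonempty family by M_graph_complete. *)
Definition M (n k : nat) : nat :=
  \max_(E : {set 'I_n * 'I_n} | M_graph k E) (gamma_c (adj E) - gamma (adj E)).

Lemma M_graph_complete n k :
  k <= n.-1 -> M_graph k [set p : 'I_n * 'I_n | p.1 != p.2].
Proof.
move=> kn; apply/and3P; split.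
- apply/andP; split; apply/forallP => x; first by rewrite /adj /= inE eqxx.
  by apply/forallP => y; rewrite /adj /= !inE [y == x]eq_sym.
- apply/forall_inP => x _; apply/forall_inP => y _.
  have [->|xy] := eqVneq x y; first exact: connect0.
  by apply: connect1; rewrite /induced /adj /= !inE.
- apply/forallP => x; rewrite /degree /adj /=.
  have -> : [set y | (x, y) \in [set p : 'I_n * 'I_n | p.1 != p.2]] = [set~ x].
    by apply/setP => y; rewrite !inE /= eq_sym.
  by rewrite cardsC1 card_ord.
Qed.

Local Open Scope ring_scope.

Definition Phi (R : realType) (x : R) : R := (x * ln (x / (x - 1)))^-1.

(* Main.v *)
Require Import Defs.
From mathcomp Require Import all_boot all_order all_algebra.
From mathcomp Require Import reals sequences exp convex interval_inference.
From mathcomp Require Import ring lra zify.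

(** Write [N = k + 1], [x = n / N] and [w = ln (ln N)].

    For the upper bound, regard the vertices of a minimum dominating set as
    roots still to be connected.  Closed neighborhoods have at least [N]
    vertices, so some vertex lies in those of a proportion [N / n] of the
    current roots; adding it to the set connects all of these roots, and it can
    replace them ([merge_roots]).  The excess of the number of roots over
    [n / N] therefore shrinks by a factor [1 - N / n] in each round.  The same
    averaging, used to build a dominating set greedily, shows that there are at
    most about [(n / N) * ln N] roots at the start ([gamma_bound]), so about
    [(n / N) * w] rounds leave only [O(n / N)] of them.  These are merged one
    after the other at the price of two vertices each, since two parts of a
    dominating set of a connected graph are at distance at most three
    ([link_roots]).  The total cost is [(n / N) * (w + O(1))].

    For the lower bound with [C <= x <= 2 * C + 1], take a large clique whose
    vertices are divided into [s] types of equal size, and [m] pairwise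
    non-adjacent centers; the center [d] is adjacent to the clique vertices
    whose type is outside a set [Z d] of types.  Guards attached to each center
    make it ruinous not to select that center.  All centers and one clique
    vertex dominate the graph, whereas a connected dominating set contains all
    centers and must provide each of them with a neighbor ([gadget_gap]).  If
    any [l] types lie in a common set [Z d], this takes more than [l] further
    vertices.  The minimum degree allows [Z d] to contain nearly a proportion
    [1 - 1 / x] of the types, and a greedy choice ([covering_design]) gives
    about [(1 - 1 / x) ^- l] sets that are enough to contain every [l] types.
    As [m] may be almost as large as [ln N], one can take [l] close to
    [w / ln (x / (x - 1))], which by convexity is at least [Phi C * x * w]; the
    factor [1 / 2] of the statement leaves room to aim at only two thirds of
    this and to absorb all errors.  For larger [x] one chains such graphs: a new
    edge between two graphs costs at most [2] in the sum of the gaps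
    ([gap_reached_glue]). *)

Set Implicit Arguments.
Unset Strict Implicit.

Import Order.TTheory GRing.Theory Num.Theory.

(** * Dominating sets *)

Section Basics.
Variables (T : finType) (e : rel T).

Definition closed_adj : rel T := [rel x y | (x == y) || e x y].

Lemma closed_adj_refl x : closed_adj x x.
Proof. by rewrite /closed_adj /= eqxx. Qed.

Lemma edge_closed_adj x y : e x y -> closed_adj x y.
Proof. by rewrite /closed_adj /= orbC => ->. Qed.

Lemma simple_graphP : simple_graph e -> irreflexive e /\ symmetric e.
Proof.
case/andP=> /forallP irr /forallP sym; split=> [x|x y]; first exact/negbTE.
by apply/eqP; move/forallP: (sym x); apply.
Qed.

Lemma dominatingP (D : {set T}) :
  reflect (forall x, exists2 y, y \in D & closed_adj x y) (dominating e D).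
Proof.
apply: (iffP forallP) => h x.
  have [xD|xD] := boolP (x \in D); first by exists x; rewrite ?closed_adj_refl.
  by have /exists_inP[y yD exy] := implyP (h x) xD; exists y; rewrite ?edge_closed_adj.
apply/implyP => xD; have [y yD /orP[/eqP exy|exy]] := h x.
  by rewrite exy yD in xD.
by apply/exists_inP; exists y.
Qed.

Lemma gamma_le (D : {set T}) : dominating e D -> gamma e <= #|D|.
Proof.
by move=> dD; rewrite /gamma; case: arg_minnP => [|? _]; [exact: dominatingT|apply].
Qed.

Lemma gamma_attained : exists2 D, dominating e D & #|D| = gamma e.
Proof.
by rewrite /gamma; case: arg_minnP => [|D dD _]; [exact: dominatingT|exists D].
Qed.

Hypothesis conn : connected_graph e.

Lemma connected_dominatingT : connected_dominating e [set: T].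
Proof. by rewrite /connected_dominating dominatingT. Qed.

Lemma gamma_c_le (D : {set T}) : connected_dominating e D -> gamma_c e <= #|D|.
Proof.
move=> dD; rewrite /gamma_c.
by case: arg_minnP => [|? _]; [exact: connected_dominatingT|apply].
Qed.

Lemma gamma_c_attained : exists2 D, connected_dominating e D & #|D| = gamma_c e.
Proof.
by rewrite /gamma_c; case: arg_minnP => [|D dD _];
  [exact: connected_dominatingT|exists D].
Qed.

End Basics.

(** * Greedy covering *)

Local Open Scope ring_scope.

(** Both sides are compared by counting the related pairs [(a, u)] in two ways. *)
Lemma exists_above_average (R : realType) (A U : finType) (r : A -> U -> bool) (rho : R)
    (W : {set U}) :
  (0 < #|A|)%N ->
  (forall u, u \in W -> rho * #|A|%:R <= #|[set a | r a u]|%:R) ->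
  exists a, rho * #|W|%:R <= #|[set u in W | r a u]|%:R.
Proof.
move=> A_gt0 hr; apply/existsP; apply: contraT; rewrite negb_exists => /forallP lt.
have [a0 _] := card_gt0P A_gt0.
have swap : (\sum_a #|[set u in W | r a u]| = \sum_(u in W) #|[set a | r a u]|)%N.
  under eq_bigr do rewrite -sum1dep_card big_mkcondr /=.
  by rewrite exchange_big; apply: eq_bigr => u _; rewrite -sum1dep_card -big_mkcond.
have: (\sum_a #|[set u in W | r a u]|)%:R < rho * #|W|%:R * #|A|%:R :> R.
  rewrite natr_sum mulr_natr -sumr_const; apply: ltr_sum => [|a _].
    by apply/hasP; exists a0; rewrite ?mem_index_enum.
  by have := lt a; rewrite -ltNge.
rewrite swap natr_sum mulrAC mulr_natr -sumr_const ltNge => /negP[].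
exact: ler_sum.
Qed.

(** Adding at each step a candidate that covers an above-average part of what is
    still uncovered. *)
Lemma greedy_cover (R : realType) (A U : finType) (r : A -> U -> bool) (rho : R) :
  (0 < #|A|)%N -> rho <= 1 ->
  (forall u, rho * #|A|%:R <= #|[set a | r a u]|%:R) ->
  forall j : nat, exists2 X : {set A}, (#|X| <= j)%N
    & #|[set u | [forall a in X, ~~ r a u]]|%:R <= (1 - rho) ^+ j * #|U|%:R.
Proof.
move=> A_gt0 rho1 hr; elim=> [|j [X Xj leX]].
  exists set0; rewrite ?cards0 // expr0 mul1r ler_nat max_card //.
set W := [set u | _] in leX.
have [a ha] := @exists_above_average R A U r rho W A_gt0 (fun u _ => hr u).
exists (a |: X); first by rewrite cardsU1; case: (a \in X); rewrite ?(leq_trans Xj).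
have -> : [set u | [forall b in a |: X, ~~ r b u]] = W :\: [set u in W | r a u].
  apply/setP => u; rewrite !inE; apply/forall_inP/idP => [h|].
    have hX : [forall b in X, ~~ r b u].
      by apply/forall_inP => b bX; apply: h; rewrite inE bX orbT.
    by rewrite hX /= (h a) // setU11.
  by case/andP=> na /forall_inP h b; rewrite !inE => /orP[/eqP->|/h//];
    move: na; rewrite negb_and; case/orP => // /negP[]; apply/forall_inP.
rewrite cardsD (setIidPr _); last by apply/subsetP => u; rewrite inE => /andP[].
rewrite natrB; last by apply/subset_leq_card/subsetP => u; rewrite inE => /andP[].
rewrite exprS -mulrA.
have : (1 - rho) * #|W|%:R <= (1 - rho) * ((1 - rho) ^+ j * #|U|%:R).
  by apply: ler_wpM2l => //; rewrite subr_ge0.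
by move: ha; lra.
Qed.

Lemma expr_onem_le_expR (R : realType) (rho : R) (j : nat) : rho <= 1 ->
  (1 - rho) ^+ j <= expR (- (rho * j%:R)).
Proof.
move=> rho1; rewrite -(mulNr rho) expRM_natr lerXn2r ?nnegrE ?subr_ge0 ?expR_ge0 //.
exact: expR_ge1Dx.
Qed.

Local Close Scope ring_scope.

(** * Connecting a dominating set *)

Lemma cardsU1_le (T : finType) (x : T) (A : {set T}) : #|x |: A| <= #|A|.+1.
Proof. by rewrite cardsU1 -add1n leq_add2r leq_b1. Qed.

Lemma connect_crossing (T : finType) (r : rel T) (S : {set T}) (x y : T) :
  connect r x y -> x \in S -> y \notin S ->
  exists u w, [/\ u \in S, w \notin S & r u w].
Proof.
case/connectP => p; elim: p x => [|z p IH] x /=; first by move=> _ -> ->.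
case/andP=> rxz rzp yE xS yS; have [zS|zS] := boolP (z \in S).
  exact: (IH z).
by exists x, z.
Qed.

Section Merging.
Variables (T : finType) (e : rel T).
Hypotheses (simp : simple_graph e) (conn : connected_graph e).

Let esym : symmetric e := proj2 (simple_graphP simp).

Lemma closed_adj_sym : symmetric (closed_adj e).
Proof. by move=> x y; rewrite /closed_adj /= eq_sym esym. Qed.

Lemma connect_induced_sym (D : {set T}) : connect_sym (induced e D).
Proof.
apply: sym_connect_sym => x y; rewrite /induced /= esym.
by rewrite andbA [(x \in D) && _]andbC -andbA.
Qed.

Lemma connect_induced_mono (D D' : {set T}) x y :
  D \subset D' -> connect (induced e D) x y -> connect (induced e D') x y.
Proof.
move=> sDD'; apply: connect_sub => u v /and3P[uD vD euv]; apply: connect1.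
by rewrite /induced /= !(subsetP sDD').
Qed.

Lemma connect_closed_adj (D : {set T}) x y :
  x \in D -> y \in D -> closed_adj e x y -> connect (induced e D) x y.
Proof.
move=> xD yD /orP[/eqP->|exy]; first exact: connect0.
by apply: connect1; rewrite /induced /= xD yD.
Qed.

(** [Rt] represents the components of the subgraph induced by [D], possibly with
    several roots in one component; the number of roots is the potential that
    the merging steps decrease. *)
Definition rooted (D Rt : {set T}) : Prop :=
  forall x, x \in D -> exists2 r, r \in Rt & connect (induced e D) x r.

Lemma rooted_refl (D : {set T}) : rooted D D.
Proof. by move=> x xD; exists x => //; exact: connect0. Qed.

(** The new vertex [v] connects all the roots in its closed neighborhood, so that
    it can serve as a root for them. *)
Lemma merge_roots (D Rt : {set T}) (v : T) : Rt \subset D -> rooted D Rt ->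
  rooted (v |: D) (v |: [set r in Rt | ~~ closed_adj e v r]).
Proof.
move=> sRD rD x; have sD : D \subset v |: D by exact: subsetU1.
case/setU1P => [->|xD].
  by exists v; rewrite ?connect0 ?setU11.
have [r rR cxr] := rD x xD.
have cxr' := connect_induced_mono sD cxr.
have [vr|nvr] := boolP (closed_adj e v r); last by exists r => //; rewrite !inE rR nvr orbT.
exists v; rewrite ?setU11 //; apply: connect_trans cxr' _.
apply: connect_closed_adj; rewrite ?setU11 //; last by rewrite closed_adj_sym.
by rewrite inE (subsetP sRD) ?orbT.
Qed.

(** The component [A] of [x0] in [D] and the rest of [D] have closed neighborhoods
    that together cover the graph.  As the graph is connected, these meet or are
    joined by an edge, which gives a path with at most two inner vertices [u] and
    [w] from [A] to the rest of [D]; adding these makes one root superfluous. *)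
Lemma link_roots (D Rt : {set T}) : dominating e D -> Rt \subset D -> rooted D Rt ->
  ~~ induced_connected e D ->
  exists D' Rt' : {set T}, [/\ [&& D \subset D', #|D'| <= #|D|.+2, Rt' \subset D' & #|Rt'| < #|Rt|]
    & rooted D' Rt'].
Proof.
move=> dD sRD rD; rewrite negb_forall_in => /exists_inP[x0 x0D].
rewrite negb_forall_in => /exists_inP[y0 y0D ncxy].
pose A := [set x in D | connect (induced e D) x0 x].
pose NA := [set x | [exists a in A, closed_adj e x a]].
have x0NA : x0 \in NA.
  by rewrite inE; apply/exists_inP; exists x0; rewrite ?closed_adj_refl // inE x0D connect0.
pose NB := [set x | [exists b in D :\: A, closed_adj e x b]].
have y0NB : y0 \in NB.
  rewrite inE; apply/exists_inP; exists y0; rewrite ?closed_adj_refl //.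
  by rewrite !inE y0D ncxy.
have cover x : (x \in NA) || (x \in NB).
  have [y yD xy] := dominatingP e D dD x.
  have [yA|yA] := boolP (y \in A).
    by apply/orP; left; rewrite inE; apply/exists_inP; exists y.
  by apply/orP; right; rewrite inE; apply/exists_inP; exists y; rewrite // inE yA.
have [u [w [uNA wNB uw]]] : exists u w, [/\ u \in NA, w \in NB & closed_adj e u w].
  have [y0NA|y0NA] := boolP (y0 \in NA); first by exists y0, y0; rewrite closed_adj_refl.
  have cxy : connect (induced e [set: T]) x0 y0.
    by move/forall_inP: conn => /(_ x0 (in_setT _))/forall_inP->; rewrite ?inE.
  have [u [w [uNA wNA /and3P[_ _ uw]]]] := connect_crossing cxy x0NA y0NA.
  by exists u, w; rewrite uNA edge_closed_adj //; split=> //; have := cover w; rewrite (negbTE wNA).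
move: uNA; rewrite inE => /exists_inP[a]; rewrite inE => /andP[aD cx0a] ua.
move: wNB; rewrite inE => /exists_inP[b]; rewrite !inE => /andP[ncx0b bD] wb.
rewrite bD /= in ncx0b.
have [ra raR cara] := rD a aD; have [rb rbR cbrb] := rD b bD.
have ne_r : ra != rb.
  apply: contraNneq ncx0b => rab; apply: connect_trans cx0a _.
  by apply: connect_trans cara _; rewrite rab connect_induced_sym.
pose D' := u |: (w |: D).
have sD : D \subset D' by apply/subsetP => x xD; rewrite !inE xD !orbT.
have uD : u \in D' by rewrite !inE eqxx.
have wD : w \in D' by rewrite !inE eqxx orbT.
have cua : connect (induced e D') u a.
  by apply: connect_closed_adj => //; exact: (subsetP sD).
have cwb : connect (induced e D') w b.
  by apply: connect_closed_adj => //; exact: (subsetP sD).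
have cura : connect (induced e D') u ra.
  exact: connect_trans cua (connect_induced_mono sD cara).
have cwra : connect (induced e D') w ra.
  by apply: connect_trans cura; apply: connect_closed_adj => //; rewrite closed_adj_sym.
have crb : connect (induced e D') rb ra.
  apply: connect_trans cwra; rewrite connect_induced_sym.
  exact: connect_trans cwb (connect_induced_mono sD cbrb).
exists D', (Rt :\ rb); split.
  rewrite sD [(#|Rt|)%N](cardsD1 rb Rt) rbR add1n ltnSn andbT /=.
  rewrite (subset_trans (subD1set _ _) (subset_trans sRD sD)) andbT.
  by apply: leq_trans (cardsU1_le _ _) _; rewrite ltnS cardsU1_le.
move=> x; case/setU1P => [->|]; first by exists ra; rewrite // !inE ne_r.
case/setU1P => [->|xD]; first by exists ra; rewrite // !inE ne_r.
have [r rR cxr] := rD x xD; have cxr' := connect_induced_mono sD cxr.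
have [rE|nr] := eqVneq r rb; last by exists r; rewrite // !inE nr.
exists ra; first by rewrite !inE ne_r.
by apply: connect_trans cxr' _; rewrite rE.
Qed.

Lemma dominating_mono (D D' : {set T}) : D \subset D' -> dominating e D -> dominating e D'.
Proof.
move=> sD /dominatingP dD; apply/dominatingP => x; have [y yD xy] := dD x.
by exists y; rewrite ?(subsetP sD).
Qed.

(** Every linking step costs two vertices and removes a root. *)
Lemma gamma_c_rooted (D Rt : {set T}) : dominating e D -> Rt \subset D -> rooted D Rt ->
  gamma_c e <= #|D| + 2 * #|Rt|.
Proof.
have [m] := ubnP #|Rt|; elim: m D Rt => // m IH D Rt ltm dD sRD rD.
have [cD|ncD] := boolP (induced_connected e D).
  by apply: leq_trans (leq_addr _ _); apply: gamma_c_le; rewrite // /connected_dominating dD.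
have [D' [Rt' [/and4P[sD leD sR' ltR] rD']]] := link_roots dD sRD rD ncD.
apply: leq_trans (IH D' Rt' _ (dominating_mono sD dD) sR' rD') _; first lia.
lia.
Qed.

End Merging.

(** * The upper bound *)

Local Open Scope ring_scope.

Section Upper.
Variables (R : realType) (T : finType) (e : rel T) (k : nat).
Hypotheses (simp : simple_graph e) (conn : connected_graph e).
Hypotheses (mindeg : min_degree_ge e k) (T_gt0 : (0 < #|T|)%N).

Let rho : R := k.+1%:R / #|T|%:R.

Lemma card_closed_adj u : (k.+1 <= #|[set a | closed_adj e a u]|)%N.
Proof.
have [irr sym] := simple_graphP simp.
have -> : [set a | closed_adj e a u] = u |: [set y | e u y].
  by apply/setP => a; rewrite !inE /closed_adj /= sym.
by rewrite cardsU1 inE irr add1n ltnS; exact: (forallP mindeg).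
Qed.

Let T_gt0R : 0 < #|T|%:R :> R. Proof. by rewrite ltr0n. Qed.

Let dense u : rho * #|T|%:R <= #|[set a | closed_adj e a u]|%:R.
Proof. by rewrite divfK ?gt_eqF // ler_nat card_closed_adj. Qed.

Lemma density_gt0 : 0 < rho.
Proof. by rewrite divr_gt0 // ltr0n. Qed.

Lemma density_le1 : rho <= 1.
Proof.
rewrite ler_pdivrMr // mul1r ler_nat.
have [u _] := card_gt0P T_gt0.
exact: leq_trans (card_closed_adj u) (max_card _).
Qed.

(** After [j] greedy choices the vertices not yet dominated are added to the
    set. *)
Lemma gamma_bound j : (gamma e)%:R <= j%:R + (1 - rho) ^+ j * #|T|%:R :> R.
Proof.
have [X Xj leU] := greedy_cover T_gt0 density_le1 dense j.
set U := [set u | _] in leU.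
have dXU : dominating e (X :|: U).
  apply/dominatingP => x; have [xU|] := boolP (x \in U).
    by exists x; rewrite ?closed_adj_refl // inE xU orbT.
  rewrite inE negb_forall_in => /exists_inP[y yX]; rewrite negbK => yx.
  by exists y; [rewrite inE yX | rewrite closed_adj_sym].
apply: le_trans (_ : (#|X| + #|U|)%:R <= _).
  by rewrite ler_nat (leq_trans (gamma_le dXU)) // cardsU leq_subr.
by rewrite natrD lerD // ler_nat.
Qed.

(** The affine map [r |-> r - rho * r + 1], which bounds the number of roots after
    a round, has fixed point [rho^-1] and slope [1 - rho]. *)
Lemma merge_rounds (D : {set T}) j : dominating e D ->
  exists D' Rt : {set T},
    [/\ dominating e D', (#|D'| <= #|D| + j)%N, Rt \subset D', rooted e D' Rt
      & #|Rt|%:R - rho^-1 <= (1 - rho) ^+ j * (#|D|%:R - rho^-1)].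
Proof.
move=> dD; elim: j => [|j [D' [Rt [dD' cD' sR rD leR]]]].
  by exists D, D; rewrite addn0 expr0 mul1r; split=> //; exact: rooted_refl.
have [v] := exists_above_average T_gt0 (fun u (_ : u \in Rt) => dense u).
set W := [set u in Rt | _] => leW.
exists (v |: D'), (v |: [set r in Rt | ~~ closed_adj e v r]); split.
- exact: dominating_mono (subsetU1 _ _) dD'.
- by rewrite addnS (leq_trans (cardsU1_le _ _)) // ltnS.
- by apply/setUS/subsetP => x; rewrite inE => /andP[/(subsetP sR)].
- exact: merge_roots.
have -> : [set r in Rt | ~~ closed_adj e v r] = Rt :\: W.
  by apply/setP => r; rewrite !inE; case: (r \in Rt); rewrite /= ?andbT ?andbF.
have sW : W \subset Rt by apply/subsetP => u; rewrite inE => /andP[].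
have : #|v |: (Rt :\: W)|%:R <= #|Rt|%:R - #|W|%:R + 1 :> R.
  rewrite -natrB ?subset_leq_card // natr1 ler_nat (leq_trans (cardsU1_le _ _)) //.
  by rewrite cardsD (setIidPr sW).
have : (1 - rho) * (#|Rt|%:R - rho^-1) <= (1 - rho) ^+ j.+1 * (#|D|%:R - rho^-1).
  by rewrite exprS -mulrA ler_wpM2l // subr_ge0 density_le1.
have : rho * rho^-1 = 1 by rewrite divff // gt_eqF // density_gt0.
move: leW; set a := rho^-1 ; nra.
Qed.

Lemma gamma_c_bound j :
  (gamma_c e)%:R <= (gamma e)%:R + j%:R
    + 2 * (rho^-1 + (1 - rho) ^+ j * (gamma e)%:R) :> R.
Proof.
have [D dD cD] := gamma_attained e.
have [D' [Rt [dD' cD' sR rD leR]]] := merge_rounds j dD.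
have rho0 := density_gt0; have rho1 := density_le1.
have : (gamma_c e)%:R <= #|D|%:R + j%:R + 2 * #|Rt|%:R :> R.
  rewrite -natrM -!natrD ler_nat (leq_trans (gamma_c_rooted simp conn dD' sR rD)) //.
  by rewrite leq_add2r.
have : 0 <= (1 - rho) ^+ j by rewrite exprn_ge0 // subr_ge0.
have : 0 <= rho^-1 by rewrite invr_ge0 ltW.
by rewrite -cD; move: leR; set a := rho^-1; set b := _ ^+ j; nra.
Qed.

(** The greedy bound is used with about [y / rho] steps, and merging with about
    [w / rho] rounds, where [w = ln y] and [y = ln N]: the latter divides the
    number of roots, which is at most [(y + 2) / rho], by [y].  The constant [18]
    makes the remaining [9 / rho] smaller than half of [w / rho]. *)
Lemma gamma_gap_bound : 18 < ln (ln k.+1%:R) :> R ->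
  (gamma_c e - gamma e)%:R < 3 / 2 * (#|T|%:R / k.+1%:R) * ln (ln k.+1%:R) :> R.
Proof.
set N : R := k.+1%:R; set y := ln N; set w := ln y => w18.
have rho0 := density_gt0; have rho1 := density_le1.
have N0 : 0 < N by rewrite ltr0n.
have y0 : 0 < y by rewrite ltNge; apply/negP => /ln0 y0; move: w18; rewrite /w y0; lra.
have expy : expR y = N by rewrite lnK.
have expw : expR w = y by rewrite lnK.
have -> : #|T|%:R / N = rho^-1 by rewrite invf_div.
set a := rho^-1.
have a1 : 1 <= a by rewrite invr_ge1 // ?unitfE gt_eqF.
have ra : rho * a = 1 by rewrite divff // gt_eqF.
(* [j] is the least integer above [x / rho], which is at most [(x + 1) / rho] since
   [1 <= 1 / rho]. *)
have round x : 0 <= x -> exists2 j : nat, x * a <= j%:R <= (x + 1) * a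
     & (1 - rho) ^+ j <= (expR x)^-1.
  move=> x0; have xa0 : 0 <= x * a by rewrite mulr_ge0 //; lra.
  have /andP[t1 t2] := truncn_itv xa0.
  exists (Num.truncn (x * a)).+1.
    by rewrite ltW //= -natr1; move: t1 t2; lra.
  apply: le_trans (expr_onem_le_expR _ density_le1) _; rewrite -expRN ler_expR lerN2.
  apply: le_trans (_ : rho * (x * a) <= _); first by rewrite mulrCA ra mulr1.
  by rewrite ler_pM2l // ltW.
have [j /andP[_ jle] pj] := round y (ltW y0).
have [i /andP[_ ile] pi] : exists2 j : nat, w * a <= j%:R <= (w + 1) * a
     & (1 - rho) ^+ j <= (expR w)^-1 by apply: round; lra.
have gb : (gamma e)%:R <= (y + 2) * a.
  apply: le_trans (gamma_bound j) _.
  have : (1 - rho) ^+ j * #|T|%:R <= a.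
    apply: le_trans (ler_wpM2r (ler0n _ _) pj) _.
    by rewrite expy mulrC /a /rho invf_div.
  by move: jle; lra.
have gap : (gamma_c e)%:R - (gamma e)%:R < 3 / 2 * a * w.
  apply: le_lt_trans (_ : (w + 9) * a < _); last by nra.
  have y1 : 1 <= y by rewrite -expw -[1]expR0 ler_expR; lra.
  have : (1 - rho) ^+ i * (gamma e)%:R <= 3 * a.
    apply: le_trans (_ : y^-1 * ((y + 2) * a) <= _).
      by apply: ler_pM => //; rewrite ?exprn_ge0 ?subr_ge0 // -expw.
    by rewrite mulrA ler_wpM2r ?(le_trans ler01) // ler_pdivrMl //; lra.
  by have := gamma_c_bound i; rewrite -/a; move: ile; lra.
by rewrite natrB // gamma_le_gamma_c.
Qed.

End Upper.

Lemma M_upper (R : realType) (n k : nat) : (0 < n)%N -> 18 < ln (ln k.+1%:R) :> R ->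
  (M n k)%:R < 3 / 2 * (n%:R / k.+1%:R) * ln (ln k.+1%:R) :> R.
Proof.
move=> n0 w18; rewrite /M.
elim/big_ind: _ => [|x y hx hy|E /and3P[simp conn mindeg]].
- by rewrite !mulr_gt0 ?invr_gt0 ?ltr0n // (lt_trans _ w18) // ltr0n.
- by case: leqP.
- have T0 : (0 < #|'I_n|)%N by rewrite card_ord.
  by have := gamma_gap_bound simp conn mindeg T0 w18; rewrite card_ord.
Qed.

Local Close Scope ring_scope.

(** * Gluing graphs *)

Lemma connect_homo (T T' : finType) (r : rel T) (r' : rel T') (f : T -> T') x y :
  {homo f : x y / r x y >-> r' x y} -> connect r x y -> connect r' (f x) (f y).
Proof.
move=> hf /connectP[p rp ->]; apply/connectP; exists (map f p); last by rewrite last_map.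
exact: homo_path rp.
Qed.

Section Collapse.
Variables (T T' : finType) (e : rel T) (e' : rel T') (f : T -> T').
Hypothesis f_surj : forall y, exists x, f x = y.
Hypothesis f_hom : forall x y, e x y -> closed_adj e' (f x) (f y).

Lemma dominating_image (S : {set T}) : dominating e S -> dominating e' (f @: S).
Proof.
move=> /dominatingP dS; apply/dominatingP => y.
have [x <-] := f_surj y; have [u uS /orP[/eqP->|xu]] := dS x.
  by exists (f u); rewrite ?closed_adj_refl ?imset_f.
by exists (f u); rewrite ?f_hom ?imset_f.
Qed.

(** A map that sends edges to edges or contracts them preserves connectedness and
    domination.  This is used for the retractions of a glued graph onto its two
    parts as well as for the transport of a graph to another vertex type. *)
Lemma connected_dominating_image (S : {set T}) :
  connected_dominating e S -> connected_dominating e' (f @: S).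
Proof.
case/andP=> dS /forall_inP cS; rewrite /connected_dominating dominating_image //=.
apply/forall_inP => _ /imsetP[x xS ->]; apply/forall_inP => _ /imsetP[y yS ->].
have /forall_inP/(_ y yS)/connectP[p] := cS x xS.
elim: p x xS => [|z p IH] x xS /=; first by move=> _ ->; exact: connect0.
case/andP=> /and3P[_ zS exz] pz yE.
apply: connect_trans (IH z zS pz yE).
by apply: connect_closed_adj; rewrite ?imset_f ?f_hom.
Qed.

End Collapse.

Lemma connected_graphP (T : finType) (e : rel T) :
  reflect (forall x y, connect e x y) (connected_graph e).
Proof.
have E : induced e [set: T] =2 e by move=> x y; rewrite /induced /= !inE.
apply: (iffP forall_inP) => h x => [y|_].
  by rewrite -(eq_connect E); move/forall_inP: (h x (in_setT _)); apply; rewrite inE.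
by apply/forall_inP => y _; rewrite (eq_connect E).
Qed.

(** Graphs on arbitrary vertex types make gluing a disjoint union of types. *)
Definition gap_reached (n k v : nat) : Prop :=
  exists (T : finType) (e : rel T),
    [/\ #|T| = n, simple_graph e, connected_graph e, min_degree_ge e k
      & gamma e + v <= gamma_c e].

Lemma gap_reached_M (n k v : nat) : gap_reached n k v -> v <= M n k.
Proof.
case=> T [e [cT simp conn mindeg gap]].
pose g (i : 'I_n) : T := enum_val (cast_ord (esym cT) i).
pose h (x : T) : 'I_n := cast_ord cT (enum_rank x).
have gK : cancel g h by move=> i; rewrite /g /h enum_valK cast_ordKV.
have hK : cancel h g by move=> x; rewrite /g /h cast_ordK enum_rankK.
pose E : {set 'I_n * 'I_n} := [set p | e (g p.1) (g p.2)].
have adjE i j : adj E i j = e (g i) (g j) by rewrite /adj /= inE.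
have [irr sym] := simple_graphP simp.
have connE : connected_graph (adj E).
  apply/connected_graphP => i j; move/connected_graphP: conn => /(_ (g i) (g j)).
  case/connectP=> p; elim: p i => [|x p IH] i /=.
    by move=> _ /(can_inj gK) ->; exact: connect0.
  case/andP=> ix px jE; apply: connect_trans (connect1 _) (IH (h x) _ _); rewrite ?hK //.
  by rewrite adjE hK.
have ME : M_graph k E.
  apply/and3P; split=> //.
    apply/andP; split; apply/forallP => i; first by rewrite adjE irr.
    by apply/forallP => j; rewrite !adjE sym.
  apply/forallP => i; apply: leq_trans (forallP mindeg (g i)) _.
  rewrite /degree -(card_imset _ (can_inj hK)); apply/subset_leq_card/subsetP => j.
  by case/imsetP=> x + ->; rewrite !in_set adjE hK.
apply: leq_trans (leq_bigmax_cond _ ME).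
have gammaE : gamma (adj E) <= gamma e.
  have [D dD <-] := gamma_attained e.
  rewrite -(card_imset _ (can_inj hK)) gamma_le //.
  apply: (dominating_image _ _ dD) => [i|x y xy]; first by exists (g i).
  by apply: edge_closed_adj; rewrite adjE !hK.
have gamma_cE : gamma_c e <= gamma_c (adj E).
  have [D dD <-] := gamma_c_attained connE.
  rewrite -(card_imset _ (can_inj gK)) gamma_c_le //.
  apply: (connected_dominating_image _ _ dD) => [x|i j ij]; first by exists (h x).
  by apply: edge_closed_adj; rewrite -adjE.
lia.
Qed.

Section Glue.
Variables (T1 T2 : finType) (e1 : rel T1) (e2 : rel T2) (z1 : T1) (z2 : T2).

Definition glue : rel (T1 + T2) := fun u v =>
  match u, v with
  | inl x, inl y => e1 x y
  | inr x, inr y => e2 x y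
  | inl x, inr y => (x == z1) && (y == z2)
  | inr y, inl x => (x == z1) && (y == z2)
  end.

Definition fold_left (u : T1 + T2) : T1 := if u is inl x then x else z1.
Definition fold_right (u : T1 + T2) : T2 := if u is inr y then y else z2.

Lemma glue_simple : simple_graph e1 -> simple_graph e2 -> simple_graph glue.
Proof.
move=> /simple_graphP[i1 s1] /simple_graphP[i2 s2].
apply/andP; split; apply/forallP => -[x|x] /=; rewrite ?i1 ?i2 //.
  by apply/forallP => -[y|y] //=; rewrite s1.
by apply/forallP => -[y|y] //=; rewrite s2.
Qed.

Lemma glue_min_degree k : min_degree_ge e1 k -> min_degree_ge e2 k ->
  min_degree_ge glue k.
Proof.
move=> /forallP d1 /forallP d2; apply/forallP => -[x|x].
  apply: leq_trans (d1 x) _; rewrite /degree -(card_imset _ (@inl_inj T1 T2)).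
  by apply/subset_leq_card/subsetP => _ /imsetP[y + ->]; rewrite !inE.
apply: leq_trans (d2 x) _; rewrite /degree -(card_imset _ (@inr_inj T1 T2)).
by apply/subset_leq_card/subsetP => _ /imsetP[y + ->]; rewrite !inE.
Qed.

Lemma glue_connected : connected_graph e1 -> connected_graph e2 -> connected_graph glue.
Proof.
move=> /connected_graphP c1 /connected_graphP c2.
have cl x y : connect glue (inl x) (inl y) by apply: connect_homo (c1 x y).
have cr x y : connect glue (inr x) (inr y) by apply: connect_homo (c2 x y).
have clr : connect glue (inl z1) (inr z2) by apply: connect1; rewrite /= !eqxx.
have crl : connect glue (inr z2) (inl z1) by apply: connect1; rewrite /= !eqxx.
apply/connected_graphP => -[x|x] [y|y] //.
  exact: connect_trans (cl x z1) (connect_trans clr (cr z2 y)).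
exact: connect_trans (cr x z2) (connect_trans crl (cl z1 y)).
Qed.

Lemma gamma_glue : gamma glue <= gamma e1 + gamma e2.
Proof.
have [D1 /dominatingP d1 <-] := gamma_attained e1.
have [D2 /dominatingP d2 <-] := gamma_attained e2.
rewrite -(card_imset _ (@inl_inj T1 T2)) -(card_imset D2 (@inr_inj T1 T2)).
apply: leq_trans (leq_of_leqif (leq_card_setU _ _)); apply: gamma_le.
apply/dominatingP => -[x|x].
  have [y yD xy] := d1 x; exists (inl y); first by rewrite inE imset_f.
  by case/orP: xy => [/eqP->|xy]; rewrite ?closed_adj_refl ?edge_closed_adj.
have [y yD xy] := d2 x; exists (inr y); first by rewrite inE orbC imset_f.
by case/orP: xy => [/eqP->|xy]; rewrite ?closed_adj_refl ?edge_closed_adj.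
Qed.

(** Folding one side onto the end of the new edge turns a connected dominating set
    of the glued graph into one of the other side, and adds to its part on that
    side at most that one vertex. *)
Lemma gamma_c_glue : connected_graph e1 -> connected_graph e2 ->
  gamma_c e1 + gamma_c e2 <= gamma_c glue + 2.
Proof.
move=> c1 c2; have [S dS <-] := gamma_c_attained (glue_connected c1 c2).
have S1 : gamma_c e1 <= #|[set x | inl x \in S]|.+1.
  apply: leq_trans (cardsU1_le z1 _).
  apply: leq_trans (gamma_c_le c1 (connected_dominating_image (f := fold_left) _ _ dS)) _.
  - by move=> x; exists (inl x).
  - move=> [x|x] [y|y] //=; [exact: edge_closed_adj| | |by rewrite closed_adj_refl];
    by case/andP=> /eqP-> _; exact: closed_adj_refl.
  - apply/subset_leq_card/subsetP => _ /imsetP[[x|x] xS ->]; rewrite !inE ?eqxx //.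
    by rewrite xS orbT.
have S2 : gamma_c e2 <= #|[set x | inr x \in S]|.+1.
  apply: leq_trans (cardsU1_le z2 _).
  apply: leq_trans (gamma_c_le c2 (connected_dominating_image (f := fold_right) _ _ dS)) _.
  - by move=> x; exists (inr x).
  - move=> [x|x] [y|y] //=; [by rewrite closed_adj_refl| | |exact: edge_closed_adj];
    by case/andP=> _ /eqP->; exact: closed_adj_refl.
  - apply/subset_leq_card/subsetP => _ /imsetP[[x|x] xS ->]; rewrite !inE ?eqxx //.
    by rewrite xS orbT.
have -> : #|S| = #|[set x | inl x \in S]| + #|[set x | inr x \in S]|.
  by rewrite -[in LHS]sum1_card big_sumType /= !sum1dep_card.
lia.
Qed.

End Glue.

Lemma gap_reached_glue n1 n2 k v1 v2 : 0 < n1 -> 0 < n2 ->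
  gap_reached n1 k v1 -> gap_reached n2 k v2 -> gap_reached (n1 + n2) k (v1 + v2 - 2).
Proof.
move=> n1_gt0 n2_gt0 [T1 [e1 [cT1 s1 c1 d1 g1]]] [T2 [e2 [cT2 s2 c2 d2 g2]]].
have /card_gt0P[z1 _] : 0 < #|T1| by rewrite cT1.
have /card_gt0P[z2 _] : 0 < #|T2| by rewrite cT2.
exists (T1 + T2)%type, (glue e1 e2 z1 z2); split.
- by rewrite card_sum cT1 cT2.
- exact: glue_simple.
- exact: glue_connected.
- exact: glue_min_degree.
- move: (gamma_glue e1 e2 z1 z2) (gamma_c_glue z1 z2 c1 c2).
  move: (gamma_le_gamma_c (glue_connected z1 z2 c1 c2)) g1 g2.
  by move: (gamma (glue _ _ _ _)) (gamma_c (glue _ _ _ _)) => a b; lia.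
Qed.

(** * A graph with a large gap *)

Section Gadget.
(* The [N0] clique vertices have types [tau b] in ['I_s].  Any set of at most [l]
   types is contained in some [Z d], and by [wide] the clique vertices with type
   outside a set of [z] types are enough for the minimum degree. *)
Variables (k s z l m N0 : nat) (tau : 'I_N0 -> 'I_s) (Z : 'I_m -> {set 'I_s}).
Hypotheses (k_gt0 : 0 < k) (m_gt1 : 1 < m) (ltkN : k < N0) (lemz : m + l <= z).
Hypothesis cardZ : forall d, #|Z d| <= z.
Hypothesis hideZ : forall I : {set 'I_s}, #|I| <= l -> exists d, I \subset Z d.
Hypothesis wide : forall A : {set 'I_s}, #|A| <= z -> k <= #|[set b | tau b \notin A]|.

(** Clique vertices, then centers, then guards.  A guard [(d, A, j)] belongs to the
    center [d] and is adjacent to the clique vertices with type outside [A]; the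
    index [j] provides more copies than a small dominating set could contain. *)
Definition gadget_vertex : finType :=
  ('I_N0 + ('I_m + 'I_m * {set 'I_s} * 'I_(m + l).+1))%type.

(** The sets [A] with more than [z] types would leave a guard with too few neighbors,
    and are replaced by the empty set to keep the type of guards simple. *)
Definition unseen (x : 'I_m + 'I_m * {set 'I_s} * 'I_(m + l).+1) : {set 'I_s} :=
  match x with
  | inl d => Z d
  | inr (_, A, _) => if #|A| <= z then A else set0
  end.

Definition guards (x y : 'I_m + 'I_m * {set 'I_s} * 'I_(m + l).+1) : bool :=
  match x, y with
  | inl d, inr (d', _, _) => d == d'
  | _, _ => false
  end.

Definition gadget : rel gadget_vertex := fun u v =>
  match u, v with
  | inl b, inl b' => b != b'
  | inl b, inr x => tau b \notin unseen x
  | inr x, inl b => tau b \notin unseen x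
  | inr x, inr y => guards x y || guards y x
  end.

Lemma card_unseen x : #|unseen x| <= z.
Proof. by case: x => [d|[[d A] j]] //=; case: ifP; rewrite ?cards0. Qed.

Lemma clique_neighbor (A : {set 'I_s}) : #|A| <= z -> exists b, tau b \notin A.
Proof.
move=> /wide/(leq_trans k_gt0)/card_gt0P[b]; rewrite inE; by exists b.
Qed.

Lemma gadget_simple : simple_graph gadget.
Proof.
apply/andP; split; apply/forallP => u.
  by case: u => [b|[d|[[d A] j]]]; rewrite /= ?eqxx.
by apply/forallP => v; case: u v => [b|x] [b'|y] //=; apply/eqP; [exact: (congr1 negb (eq_sym _ _)) | exact: orbC].
Qed.

Lemma gadget_connected : connected_graph gadget.
Proof.
have sc : connect_sym gadget.
  by apply: sym_connect_sym; exact: (proj2 (simple_graphP gadget_simple)).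
pose b0 := Ordinal (leq_ltn_trans (leq0n k) ltkN).
have to0 u : connect gadget u (inl b0).
  have clique b : connect gadget (inl b) (inl b0).
    have [->|nb] := eqVneq b b0; first exact: connect0.
    exact: connect1.
  case: u => // x; have [b bx] := clique_neighbor (card_unseen x).
  by apply: connect_trans (clique b); exact: connect1.
by apply/connected_graphP => u v; apply: connect_trans (to0 u) _; rewrite sc.
Qed.

Definition clique_vertex (b : 'I_N0) : gadget_vertex := inl b.

Lemma clique_vertex_inj : injective clique_vertex.
Proof. by move=> b b' []. Qed.

Lemma gadget_min_degree : min_degree_ge gadget k.
Proof.
apply/forallP => -[b|x].
  apply: (@leq_trans #|[set~ b]|).
    by rewrite cardsC1 card_ord; case: N0 b ltkN => //= ? [].
  rewrite -(card_imset _ clique_vertex_inj); apply/subset_leq_card/subsetP.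
  by move=> _ /imsetP[b' + ->]; rewrite !inE /= eq_sym.
apply: leq_trans (wide (card_unseen x)) _.
rewrite -(card_imset _ clique_vertex_inj); apply/subset_leq_card/subsetP.
by move=> _ /imsetP[b' + ->]; rewrite !inE.
Qed.

Lemma gadget_gamma : gamma gadget <= m.+1.
Proof.
pose b0 := Ordinal (leq_ltn_trans (leq0n k) ltkN).
pose c (d : 'I_m) : gadget_vertex := inr (inl d).
apply: (@leq_trans #|inl b0 |: c @: setT|).
  apply: gamma_le; apply/dominatingP => -[b|[d|[[d A] j]]].
  - exists (inl b0); rewrite ?setU11 //.
    have [->|nb] := eqVneq b b0; first exact: closed_adj_refl.
    exact: edge_closed_adj.
  - by exists (c d); rewrite ?closed_adj_refl // inE imset_f ?orbT.
  - by exists (c d); [rewrite inE imset_f ?orbT | apply: edge_closed_adj; rewrite /= eqxx].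
apply: leq_trans (cardsU1_le _ _) _; rewrite ltnS.
by apply: leq_trans (leq_imset_card _ _) _; rewrite cardsT card_ord.
Qed.

(** If the center [d] is not selected, let [A] be the set of types of the selected
    clique vertices.  Unless [A] has more than [z] elements, the guards
    [(d, A, j)] have no selected neighbor, and all of them must be selected,
    which is too many.  If all centers are selected, then connectedness gives each
    of them a selected neighbor; replacing the selected guards by clique vertices
    adjacent to their centers, one gets a set of types contained in no [Z d],
    hence of size more than [l]. *)
Lemma gadget_gamma_c (S : {set gadget_vertex}) :
  connected_dominating gadget S -> m + l < #|S|.
Proof.
case/andP=> /dominatingP dS /forall_inP cS.
pose SB := [set b | inl b \in S].
pose SC := [set d | inr (inl d) \in S].
pose SP := [set p | inr (inr p) \in S].
have cardS : #|S| = #|SB| + (#|SC| + #|SP|).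
  by rewrite -[in LHS]sum1_card 2!big_sumType /= !sum1dep_card.
have [d dS'|fullC] := pickP [pred d | d \notin SC].
  have [small|large] := leqP #|tau @: SB| z; last first.
    have : #|tau @: SB| <= #|SB| by exact: leq_imset_card.
    rewrite cardS; lia.
  pose p j : 'I_m * {set 'I_s} * 'I_(m + l).+1 := (d, tau @: SB, j).
  have pI : injective p by move=> i j [].
  suff : #|p @: setT| <= #|SP|.
    by rewrite (card_imset _ pI) cardsT card_ord cardS; lia.
  apply/subset_leq_card/subsetP => _ /imsetP[j _ ->]; rewrite inE.
  have [y yS /orP[/eqP-> //|]] := dS (inr (inr (p j))).
  case: y yS => [b|[d'|q]] yS //=.
    by rewrite small imset_f // inE.
  by move=> /eqP dE; rewrite -dE in dS'; rewrite /= inE yS in dS'.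
have SCT : #|SC| = m.
  rewrite -[RHS]card_ord -cardsT; congr #|pred_of_set _|; apply/setP => d.
  by rewrite in_setT; have := fullC d => /= /negbFE.
rewrite ltnNge; apply/negP => small.
have /fin_all_exists[g gZ] : forall d : 'I_m, exists b, tau b \notin Z d.
  by move=> d; exact: clique_neighbor (cardZ d).
pose I := tau @: SB :|: [set tau (g q.1.1) | q in SP].
have /hideZ[d /subsetP sId] : #|I| <= l.
  apply: leq_trans (leq_of_leqif (leq_card_setU _ _)) _.
  have : #|tau @: SB| <= #|SB| by exact: leq_imset_card.
  have : #|[set tau (g q.1.1) | q in SP]| <= #|SP| by exact: leq_imset_card.
  by move: small; rewrite cardS SCT; lia.
have inS d' : inr (inl d') \in S by have := fullC d' => /= /negbFE; rewrite inE.
have [d' d'd] : exists d', d' != d.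
  have /card_gt0P[d' d'P] : 0 < #|[set~ d]| by rewrite cardsC1 card_ord; lia.
  by exists d'; rewrite !inE in d'P.
have cdd' : connect (induced gadget S) (inr (inl d)) (inr (inl d')).
  by move/forall_inP: (cS _ (inS d)); apply.
have [||u [v [/set1P-> _ /and3P[_]]]] := connect_crossing (S := [set inr (inl d)]) cdd'.
- by rewrite inE.
- by rewrite inE; apply: contraNneq d'd => -[->].
case: v => [b|[//|[[d1 A] j]]] vS /=.
  by rewrite sId // inE imset_f // inE.
rewrite orbF => /eqP dE; have /negP[] := gZ d; apply: sId; rewrite inE; apply/orP; right.
by apply/imsetP; exists (d1, A, j); rewrite ?inE //= dE.
Qed.

(** All centers and one clique vertex form a dominating set of size [m + 1]. *)
Lemma gadget_gap : gap_reached (N0 + (m + m * 2 ^ s * (m + l).+1)) k l.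
Proof.
exists gadget_vertex, gadget; split.
- rewrite !card_sum !card_prod !card_ord -cardsT; congr (_ + (_ + _ * _ * _)).
  by rewrite -powersetT card_powerset cardsT card_ord.
- exact: gadget_simple.
- exact: gadget_connected.
- exact: gadget_min_degree.
- have [S dS <-] := gamma_c_attained gadget_connected.
  apply: leq_trans (gadget_gamma_c dS).
  by rewrite -addSn leq_add2r gadget_gamma.
Qed.

End Gadget.

(** * Covering designs *)

(** The default [x0] pads the list of elements when there are fewer than [m]. *)
Lemma enumerate_set (T : finType) (x0 : T) (X : {set T}) m : #|X| <= m ->
  exists f : 'I_m -> T, (forall i, f i \in x0 |: X) /\ (forall x, x \in X -> exists i, f i = x).
Proof.
move=> leXm; exists (fun i => nth x0 (enum X) i); split=> [i|x xX].
  rewrite in_setU1; have [lti|gei] := ltnP i (size (enum X)).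
    by rewrite -mem_enum mem_nth ?orbT.
  by rewrite nth_default ?eqxx.
have ltx : index x (enum X) < m.
  by apply: leq_trans leXm; rewrite cardE index_mem mem_enum.
by exists (Ordinal ltx); rewrite /= nth_index ?mem_enum.
Qed.

(** The proportion of the [z]-subsets of an [s]-set that contain a given [j]-subset
    is the product of the fractions [(z - i) / (s - i)] for [i < j], each of which
    is at least [(z - l) / s]. *)
Lemma bin_ratio s z l j : j <= l -> l <= z -> z <= s ->
  (z - l) ^ l * 'C(s, z) <= s ^ l * 'C(s - j, z - j).
Proof.
move=> lejl lelz lezs.
suff H : (z - l) ^ j * 'C(s, z) <= s ^ j * 'C(s - j, z - j).
  (* The other [l - j] factors are compared by [z - l <= s]. *)
  have E a : a ^ l = a ^ (l - j) * a ^ j by rewrite -expnD subnK.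
  rewrite !E -!mulnA; apply: leq_mul H.
  by case: (l - j) => // i; rewrite leq_exp2r //; lia.
elim: j lejl => [|j IH] lejl; first by rewrite !subn0.
apply: leq_trans (_ : (z - l) * (s ^ j * 'C(s - j, z - j)) <= _).
  by rewrite expnS -mulnA leq_mul2l IH ?orbT // ltnW.
rewrite mulnCA expnSr -!mulnA leq_mul2l; apply/orP; right.
have zj : z - j = (z - j.+1).+1 by lia.
have sj : s - j = (s - j.+1).+1 by lia.
apply: leq_trans (_ : (z - j) * 'C(s - j, z - j) <= _).
  by rewrite leq_mul2r leq_sub2l ?orbT // ltnW.
by rewrite zj sj -mul_bin_diag leq_mul2r; apply/orP; right; lia.
Qed.

Lemma card_supersets (T : finType) (J : {set T}) z : #|J| <= z ->
  'C(#|T| - #|J|, z - #|J|) <= #|[set Z : {set T} | (#|Z| == z) && (J \subset Z)]|.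
Proof.
move=> leJz; have -> : #|T| - #|J| = #|~: J| by rewrite [RHS]cardsCs setCK.
rewrite -cards_draws.
rewrite -(card_in_imset (f := fun Y => Y :|: J)); last first.
  move=> Y1 Y2; rewrite !inE => /andP[/subsetP s1 _] /andP[/subsetP s2 _] eqY.
  apply/setP => x; have := congr1 (fun S : {set T} => x \in S) eqY.
  have := s1 x; have := s2 x; rewrite /= !inE.
  by case: (x \in Y1) (x \in Y2) (x \in J) => [] [] [] //= h1 h2; 
    rewrite ?(h1 isT) ?(h2 isT).
apply/subset_leq_card/subsetP => _ /imsetP[Y + ->]; rewrite !inE => /andP[sY /eqP cY].
rewrite subsetUr andbT cardsU disjoint_setI0; first by rewrite cards0 subn0 cY subnK.
by rewrite disjoints_subset.
Qed.

Local Open Scope ring_scope.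

(** Greedy covering, where the candidates are the sets of exactly [z] types and
    the objects to be covered are the [l]-tuples of types: the hypothesis says
    that less than one tuple remains uncovered after [m] steps. *)
Lemma covering_design (R : realType) (s z l m : nat) :
  (0 < s)%N -> (l <= z)%N -> (z <= s)%N ->
  (1 - ((z - l)%:R / s%:R) ^+ l) ^+ m * s%:R ^+ l < 1 :> R ->
  exists Z : 'I_m -> {set 'I_s}, (forall d, (#|Z d| <= z)%N) /\
    (forall I : {set 'I_s}, (#|I| <= l)%N -> exists d, I \subset Z d).
Proof.
move=> s_gt0 lelz lezs small.
pose A := {Z : {set 'I_s} | #|Z| == z}.
pose img (u : {ffun 'I_l -> 'I_s}) := u @: setT.
(* A tuple may repeat a type, so its image has at most [l] elements. *)
have card_img u : (#|img u| <= l)%N.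
  by apply: leq_trans (leq_imset_card _ _) _; rewrite cardsT card_ord.
pose r (a : A) (u : {ffun 'I_l -> 'I_s}) := img u \subset val a.
have cardA : #|{: A}| = 'C(s, z).
  by rewrite card_sig -[s in RHS]card_ord -card_draws cardsE.
have A_gt0 : (0 < #|{: A}|)%N by rewrite cardA bin_gt0.
pose rho : R := ((z - l)%:R / s%:R) ^+ l.
have s0 : 0 < s%:R :> R by rewrite ltr0n.
have rho1 : rho <= 1.
  rewrite exprn_ile1 ?divr_ge0 ?ler0n // ler_pdivrMr // mul1r ler_nat; lia.
have dense u : rho * #|{: A}|%:R <= #|[set a | r a u]|%:R.
  rewrite /rho expr_div_n mulrAC ler_pdivrMr ?exprn_gt0 // cardA.
  rewrite -!natrX -!natrM ler_nat mulnC [leqRHS]mulnC mulnC.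
  apply: leq_trans (bin_ratio (card_img u) lelz lezs) _.
  rewrite leq_mul2l; apply/orP; right.
  have := card_supersets (leq_trans (card_img u) lelz); rewrite card_ord => /leq_trans.
  apply; rewrite -[leqRHS](card_imset _ val_inj); apply/subset_leq_card/subsetP => Z.
  by rewrite inE => /andP[cZ uZ]; apply/imsetP; exists (Sub Z cZ : A); rewrite ?inE.
have [X leX] := greedy_cover A_gt0 rho1 dense m.
rewrite card_ffun !card_ord natrX => /le_lt_trans/(_ small).
rewrite -[1]/(1%:R) ltr_nat ltnS leqn0 cards_eq0 => /eqP U0.
have [a0 _] := card_gt0P A_gt0.
have [f [fX Xf]] := enumerate_set a0 leX.
exists (fun d => val (f d)); split=> [d|I leI]; first by rewrite (eqP (valP (f d))).
have [g [_ gI]] := enumerate_set (Ordinal s_gt0) leI.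
have := in_set0 [ffun i => g i]; rewrite -U0 inE => /negbT.
rewrite negb_forall_in => /exists_inP[a /Xf[d <-]]; rewrite negbK /r => sub.
exists d; apply: subset_trans sub; apply/subsetP => x /gI[i <-].
by apply/imsetP; exists i; rewrite ?ffunE.
Qed.

Local Close Scope ring_scope.

(** * Choice of the parameters *)

(** Types are the residues modulo [s]; the numbers [q * s + i] with
    [q < N0 %/ s] have type [i]. *)
Lemma card_mod_classes (N0 s : nat) (s_gt0 : 0 < s) (A : {set 'I_s}) :
  (s - #|A|) * (N0 %/ s) <=
    #|[set b : 'I_N0 | Ordinal (ltn_pmod b s_gt0) \notin A]|.
Proof.
pose g (p : 'I_s * 'I_(N0 %/ s)) : nat := p.2 * s + p.1.
have gN p : g p < N0.
  case: p => i q; rewrite /g /=; apply: leq_trans (leq_trunc_div N0 s).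
  by apply: (@leq_trans (q.+1 * s)); rewrite ?leq_mul2r ?ltn_ord ?orbT // mulSn addnC ltn_add2r.
pose f p := Ordinal (gN p).
have fI : injective f.
  move=> [i q] [i' q'] /(congr1 val); rewrite /= /g /= => E.
  have Ei : val i = val i'.
    by have := congr1 (modn^~ s) E; rewrite !modnMDl !modn_small.
  have Eq : val q = val q'.
    by move/eqP: E; rewrite [val i]Ei eqn_add2r eqn_pmul2r // => /eqP.
  by rewrite (val_inj Ei) (val_inj Eq).
rewrite -[s in s - _]card_ord -[X in X - _](cardsC A) addKn.
rewrite -[N0 %/ s]card_ord -[#|'I_(N0 %/ s)|]cardsT -cardsX -(card_imset _ fI).
apply/subset_leq_card/subsetP => _ /imsetP[[i q] + ->]; rewrite !inE andbT.
congr (~~ (_ \in A)); apply: val_inj.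
by rewrite /= /g /= modnMDl modn_small.
Qed.

Lemma gap_from_design (R : realType) (k s z l m N0 : nat) :
  (0 < k < N0)%N -> (1 < m)%N -> (m + l <= z)%N -> (z <= s)%N ->
  (k <= (s - z) * (N0 %/ s))%N ->
  ((1 - ((z - l)%:R / s%:R) ^+ l) ^+ m * s%:R ^+ l < 1 :> R)%R ->
  gap_reached (N0 + (m + m * 2 ^ s * (m + l).+1)) k l.
Proof.
move=> /andP[k_gt0 ltkN] m_gt1 lemz lezs enough small.
have s_gt0 : 0 < s by lia.
have [|Z [cardZ hideZ]] := covering_design s_gt0 _ lezs small; first lia.
apply: (gadget_gap (z := z) (tau := fun b : 'I_N0 => Ordinal (ltn_pmod b s_gt0)) (Z := Z)) => //.
move=> A leA; apply: leq_trans (card_mod_classes N0 s_gt0 A).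
by apply: leq_trans enough _; rewrite leq_mul2r leq_sub2l ?orbT.
Qed.

Local Open Scope ring_scope.

(** The exponential lies below its chord on the segment from [- a] to [0]. *)
Lemma expR_chord (R : realType) (theta a : R) : 0 <= theta <= 1 ->
  expR (- (theta * a)) <= 1 - theta * (1 - expR (- a)).
Proof.
move=> /andP[t0 t1].
have := convex_expR (@Itv01 _ theta t0 t1) (- a) 0.
by rewrite !convRE /= expR0 /unstable.onem mulr0 addr0 mulrN; lra.
Qed.

Lemma expR_ge_cubic (R : realType) (x : R) : 0 <= x -> x ^+ 3 / 6 <= expR x.
Proof. by move=> x0; have := expR_ge1Dxn 2 x0; rewrite /= (_ : 3`! = 6%N) //; lra. Qed.

(** With [rho = ((z - l) / s) ^ l >= exp (- h)], the left-hand side is at most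
    [exp (l * ln s - rho * m)]. *)
Lemma failure_lt1 (R : realType) (s z l m : nat) (g h : R) :
  (0 < s)%N -> (z <= s)%N ->
  expR (- g) <= (z - l)%:R / s%:R -> g * l%:R <= h -> l%:R * ln s%:R * expR h < m%:R ->
  (1 - ((z - l)%:R / s%:R) ^+ l) ^+ m * s%:R ^+ l < 1 :> R.
Proof.
move=> s_gt0 lezs leg legh ltm.
have s0 : 0 < s%:R :> R by rewrite ltr0n.
set rho := _ ^+ l.
have rho_ge : expR (- h) <= rho.
  apply: le_trans (_ : expR (- g) ^+ l <= _).
    by rewrite -expRM_natr ler_expR mulNr lerN2.
  by rewrite lerXn2r // nnegrE ?expR_ge0 // divr_ge0.
have rho1 : rho <= 1.
  rewrite exprn_ile1 ?divr_ge0 ?ler0n // ler_pdivrMr // mul1r ler_nat; lia.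
have -> : s%:R ^+ l = expR (l%:R * ln s%:R) :> R by rewrite expRM_natl lnK.
apply: le_lt_trans (ler_wpM2r (expR_ge0 _) (expr_onem_le_expR _ rho1)) _.
rewrite -expRD expR_lt1 addrC subr_lt0.
apply: lt_le_trans (ler_wpM2r (ler0n _ _) rho_ge).
by rewrite expRN [ltRHS]mulrC ltr_pdivlMr ?expR_gt0.
Qed.

(** The left-hand side is the number of centers and guards, plus the loss [s] from
    rounding the size of the types; [2 ^ s <= exp (y / 2)] because [2 <= exp 1]. *)
Lemma overhead_bound (R : realType) (s m l : nat) (y : R) :
  (0 < s)%N -> (m + l <= s)%N -> s%:R <= y / 2 ->
  (m + m * 2 ^ s * (m + l).+1)%:R + s%:R <= y ^+ 2 * expR (y / 2).
Proof.
move=> s_gt0 lemls s_le.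
have nat_le : (m + m * 2 ^ s * (m + l).+1 + s <= (2 * s) * (2 * s) * 2 ^ s)%N.
  have p1 : (0 < 2 ^ s)%N by rewrite expn_gt0.
  have lem : (m <= s)%N by lia.
  have : (m * 2 ^ s * (m + l).+1 <= s * 2 ^ s * (s + s))%N.
    by rewrite !leq_mul //; lia.
  have : (s * 1 <= s * (s * 2 ^ s))%N by rewrite leq_mul2l muln_gt0 s_gt0 p1 orbT.
  by move: (2 ^ s)%N => p; nia.
have two_le : 2 ^+ s <= expR (y / 2).
  apply: le_trans (_ : expR 1 ^+ s <= _).
    rewrite lerXn2r ?nnegrE ?expR_ge0 ?ler0n //.
    by have := expR_ge1Dx (1 : R); lra.
  by rewrite -expRM_natl mulr1 ler_expR.
have s2y : (2 * s)%:R <= y by rewrite natrM; lra.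
apply: le_trans (_ : (2 * s)%:R * (2 * s)%:R * 2 ^+ s <= _).
  by rewrite -natrD -natrX -!natrM ler_nat.
by rewrite expr2; apply: ler_pM => //; apply: ler_pM.
Qed.

(** Up to rounding, [s - z] types contain a proportion [v + eps] of the [N0] clique
    vertices, where [v = 1 / x] and [N0] is nearly [x * N]; the surplus [eps * x]
    pays for the vertices lost. *)
Lemma enough_neighbors (R : realType) (k s z N0 : nat) (v eps N x : R) :
  (0 < s)%N -> z%:R <= (1 - v - eps) * s%:R -> 0 <= v <= 1 -> 0 <= eps <= 1 -> 1 <= x ->
  x * v = 1 -> 0 <= N -> k%:R <= N ->
  x * N - eps / 4 * N <= N0%:R - s%:R -> (k <= (s - z) * (N0 %/ s))%N.
Proof.
move=> s_gt0 z_le /andP[v0 v1] /andP[e0 e1] x1 xv N_ge0 kN N0_ge.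
have lezs : (z <= s)%N.
  by rewrite -(ler_nat R); apply: le_trans z_le _; apply: ler_piMl => //; lra.
rewrite -(ler_nat R); apply: le_trans kN _; rewrite natrM natrB //.
set D := (N0 %/ s)%N.
have D_ge : N0%:R - s%:R <= s%:R * D%:R :> R.
  rewrite lerBlDr -natrM -natrD ler_nat.
  by have := divn_eq N0 s; have := ltn_pmod N0 s_gt0; rewrite -/D; lia.
apply: le_trans (_ : (v + eps) * (s%:R * D%:R) <= _); last first.
  by rewrite mulrA; apply: ler_wpM2r => //; lra.
apply: le_trans (_ : (v + eps) * (x * N - eps / 4 * N) <= _); last first.
  by apply: ler_wpM2l; [exact: addr_ge0 | exact: le_trans D_ge].
have -> : (v + eps) * (x * N - eps / 4 * N)
    = x * v * N + eps * (x - v / 4 - eps / 4) * N by ring.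
rewrite xv mul1r lerDl; apply: mulr_ge0 => //.
by apply: mulr_ge0 => //; lra.
Qed.

Section Asymptotics.
Variables (R : realType) (C X : R).
Hypotheses (C1 : 1 < C) (CX : C <= X).

(* [Lam] is the inverse of [Phi C], and [q0] the proportion of non-neighbors for
   [x = C].  The margin [eps] is chosen so that [q0 - 2 * eps] is [q0] times
   [exp (- Lam / (4 * X))].  As the number [l] will be about [2 / 3 * x * w / Lam],
   it is at most [K * w]. *)
Let Lam : R := C * ln (C / (C - 1)).
Let q0 : R := 1 - C^-1.
Let eps : R := q0 * (1 - expR (- (Lam / (4 * X)))) / 2.
Let K : R := 2 / 3 * X / Lam.

Let C0 : 0 < C. Proof. by move: C1; lra. Qed.
Let X0 : 0 < X. Proof. exact: lt_le_trans CX. Qed.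

Lemma Lam_gt0 : 0 < Lam.
Proof.
by rewrite mulr_gt0 // ln_gt0 // ltr_pdivlMr ?mul1r; move: C1; lra.
Qed.

Lemma expR_Lam : expR (- (Lam / C)) = q0.
Proof.
rewrite /Lam mulrAC divff ?gt_eqF // mul1r expRN lnK; last first.
  by rewrite posrE divr_gt0 //; move: C1; lra.
by rewrite invf_div mulrBl divff ?gt_eqF // mul1r.
Qed.

Lemma q0_itv : 0 < q0 < 1.
Proof. by rewrite -expR_Lam expR_gt0 expR_lt1 oppr_lt0 divr_gt0 // Lam_gt0. Qed.

Lemma eps_itv : 0 < eps <= q0 / 2.
Proof.
have /andP[q00 q01] := q0_itv.
have : expR (- (Lam / (4 * X))) < 1.
  by rewrite expR_lt1 oppr_lt0 divr_gt0 ?Lam_gt0 // mulr_gt0.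
have := expR_gt0 (- (Lam / (4 * X))); rewrite /eps; set a := expR _ => a0 a1.
apply/andP; split; last by nra.
by rewrite divr_gt0 // mulr_gt0 //; lra.
Qed.

(** Convexity of the exponential gives [exp (- Lam / x) <= 1 - 1 / x], with equality
    at [x = C].  The loss of [2 * eps] is paid by the factor [5 / 4] in the exponent,
    uniformly in [x]. *)
Lemma nonneighbor_rate x : C <= x <= X ->
  expR (- (5 / 4 * (Lam / x))) <= 1 - x^-1 - 2 * eps.
Proof.
move=> /andP[Cx xX]; have x0 : 0 < x := lt_le_trans C0 Cx.
have Lam0 := Lam_gt0; have /andP[q00 q01] := q0_itv.
have chord : expR (- (Lam / x)) <= 1 - x^-1.
  have -> : Lam / x = C / x * (Lam / C) by field; rewrite !gt_eqF.
  apply: le_trans (expR_chord _ _) _.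
    by rewrite ler_pdivrMr // mul1r Cx andbT divr_ge0 // ltW.
  rewrite expR_Lam /q0 opprB addrCA subrr addr0.
  by rewrite mulrAC divff ?gt_eqF // mul1r.
have tq : q0 <= expR (- (Lam / x)).
  by rewrite -expR_Lam ler_expR lerN2 ler_pM2l // lef_pV2 ?posrE.
have -> : expR (- (5 / 4 * (Lam / x))) = expR (- (Lam / x)) * expR (- (Lam / (4 * x))).
  by rewrite -expRD; congr expR; field; rewrite gt_eqF.
have : expR (- (Lam / (4 * x))) <= expR (- (Lam / (4 * X))).
  by rewrite ler_expR lerN2 ler_pM2l // lef_pV2 ?posrE ?mulr_gt0 // ler_pM2l.
have : expR (- (Lam / (4 * X))) < 1.
  by rewrite expR_lt1 oppr_lt0 divr_gt0 ?Lam_gt0 // mulr_gt0.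
rewrite /eps; move: chord tq; set t := expR (- (Lam / x)).
set a := expR _; set b := expR _; nra.
Qed.

(** The sum of the lower bounds on [w] that the estimates of [threshold_bounds]
    require. *)
Definition threshold : R :=
  192 / eps + 4 * (K + 3) / eps + 72 * 72 * (2 * K + 4) / q0 + 18 * (Lam / C) + 19.

(** With [y = exp w = ln N], these say in turn that [l + 1 <= eps * s], that
    [m + l <= z], that the [exp (y / 2) * y ^ 2] centers and guards are few compared
    with [N = exp y], and that rounding [l] is harmless. *)
Lemma threshold_bounds w : threshold <= w ->
  [/\ K * w + 1 <= eps * (expR w / 2 - 1),
      K * w * w * expR (5 / 6 * w) + K * w + 3 <= q0 / 2 * (expR w / 2 - 1),
      expR w ^+ 2 <= eps / 4 * expR (expR w / 2) & 18 * (Lam / C) <= w] /\ 19 <= w.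
Proof.
have Lam0 := Lam_gt0; have /andP[q00 q01] := q0_itv; have /andP[e0 e1] := eps_itv.
have K0 : 0 < K by rewrite !mulr_gt0 ?invr_gt0.
have p1 : 0 < 192 / eps by rewrite divr_gt0 ?ltr0n.
have p2 : 0 < 4 * (K + 3) / eps by rewrite divr_gt0 // mulr_gt0 //; lra.
have p3 : 0 < 72 * 72 * (2 * K + 4) / q0 by rewrite divr_gt0 ?mulr_gt0 //; lra.
have p4 : 0 < 18 * (Lam / C) by rewrite mulr_gt0 // divr_gt0.
rewrite /threshold => lew; have w19 : 19 <= w by lra.
have w0 : 0 <= w by lra.
have h1 : 192 <= w * eps by rewrite -ler_pdivrMr //; lra.
have h2 : 4 * (K + 3) <= w * eps by rewrite -ler_pdivrMr //; lra.
have h3 : 72 * 72 * (2 * K + 4) <= w * q0 by rewrite -ler_pdivrMr //; lra.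
have cub : w ^+ 3 / 6 <= expR w := expR_ge_cubic w0.
have w3 : w ^+ 3 = w * w * w by rewrite !exprS expr0 mulr1 mulrA.
split=> //; split; last by lra.
- nra.
(* Since [exp w = exp (5 / 6 * w) * exp (w / 6)], the second bound compares [w ^ 2]
   with a cubic lower bound of [exp (w / 6)]. *)
- have -> : expR w = expR (5 / 6 * w) * expR (w / 6).
    by rewrite -expRD; congr expR; field.
  have : (w / 6) ^+ 3 / 6 <= expR (w / 6) by apply: expR_ge_cubic; lra.
  have : 1 <= expR (5 / 6 * w) by apply: le_trans (expR_ge1Dx _); lra.
  rewrite expr_div_n w3; set b := expR _; set a := expR _ => b1 cub6.
  have a_ge : w * w * w / (36 * 36) <= a by apply: le_trans cub6; lra.
  have : K * w * w * b + K * w + 4 <= b * (w * w) * (2 * K + 4).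
    have w1 : 1 <= w by lra.
    have ww : w <= w * w by nra.
    have wwb : w * w <= b * (w * w) by nra.
    nra.
  have : b * (w * w) * (2 * K + 4) <= q0 / 4 * (b * a).
    have : q0 * b * (w * w * w / (36 * 36)) <= q0 * b * a.
      by rewrite ler_wpM2l // mulr_ge0 //; lra.
    have : b * (w * w) * (72 * 72 * (2 * K + 4)) <= b * (w * w) * (w * q0).
      by rewrite ler_wpM2l // mulr_ge0 ?mulr_ge0 //; lra.
    lra.
  lra.
- set y := expR w.
  have yw : w <= y by have := expR_ge1Dx w; rewrite -/y; lra.
  have : (y / 2) ^+ 3 / 6 <= expR (y / 2) by apply: expR_ge_cubic; lra.
  have y3 : y ^+ 3 = y * y * y by rewrite !exprS expr0 mulr1 mulrA.
  rewrite expr_div_n y3 expr2; set b := expR _ => cub2.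
  have : eps * (y * y * y) <= eps * (48 * b) by rewrite ler_wpM2l ?(ltW e0) //; lra.
  have : 192 * (y * y) <= eps * y * (y * y).
    by rewrite ler_wpM2r ?mulr_ge0 //; nra.
  lra.
Qed.

Lemma nat_floor (r : R) : 0 <= r -> exists2 p : nat, p%:R <= r & r < p%:R + 1.
Proof. by move=> /truncn_itv/andP[]; rewrite -natr1; exists (Num.truncn r). Qed.

(** The parameters are [s] about [y / 2], so that the number [2 ^ s] of sets of types
    is at most the square root of [N]; [l] about [2 / 3 * x * w / Lam]; [z] about
    [(1 - 1 / x - eps) * s]; and [m] just above [l * ln s * exp (5 / 6 * w)], the number
    of steps of the greedy covering.  Here [5 / 6] is the product of [2 / 3] and the
    factor [5 / 4] of [nonneighbor_rate]; it is less than [1], so that [m] is much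
    smaller than [s]. *)
Lemma gadget_asymptotic_exp (k n : nat) (w y x : R) :
  expR w = y -> expR y = k.+1%:R -> x * k.+1%:R = n%:R -> C <= x <= X ->
  threshold <= w ->
  exists2 l, gap_reached n k l & x * w / (2 * Lam) + 2 <= l%:R.
Proof.
move=> expw; move NE : (k.+1%:R : R) => N expy xN /andP[Cx xX] lew.
have [[E2 E1 E3 E4] w19] := threshold_bounds lew; clear lew.
have Lam0 := Lam_gt0; have /andP[q00 q01] := q0_itv; have /andP[e0 e1] := eps_itv.
have rate_x : expR (- (5 / 4 * (Lam / x))) <= 1 - x^-1 - 2 * eps.
  by apply: nonneighbor_rate; rewrite Cx.
have KLam : K * Lam = 2 / 3 * X by rewrite /K divfK // gt_eqF.
have q0E : 1 - q0 = C^-1 by rewrite /q0 opprB addrC subrK.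
clearbody K eps q0 Lam.
have N0 : 0 < N by rewrite -NE ltr0n.
have e1' : eps <= (C - 1) / 2.
  apply: le_trans e1 _; rewrite ler_pM2r ?invr_gt0 // -[q0](subKr 1) q0E.
  have : C * C^-1 = 1 by rewrite divff // gt_eqF.
  have : C^-1 <= 1 by rewrite invf_le1 // ltW.
  have : 0 < C^-1 by rewrite invr_gt0.
  nra.
move: E1 E2 E3; rewrite expw => E1 E2 E3.
have yw : w + 1 <= y by rewrite -expw addrC; exact: expR_ge1Dx.
have x0 : 0 < x := lt_le_trans C0 Cx.
have [v v0 xv] : exists2 v, 0 < v & x * v = 1.
  by exists x^-1; rewrite ?invr_gt0 // divff // gt_eqF.
have vE : x^-1 = v by rewrite -[x^-1]mulr1 -xv mulKf // lt0r_neq0.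
have vC : v <= 1 - q0 by rewrite q0E -vE lef_pV2 ?posrE.
have v1 : v <= 1 by lra.
have half_q0 : 0 <= q0 / 2 by lra.
have q0_margin : q0 / 2 <= 1 - v - eps by lra.
have y2 : 0 <= y / 2 by lra.
have y2' : 0 <= y / 2 - 1 by lra.
have [s s_le s_gt] := nat_floor y2.
have s_ge : y / 2 - 1 <= s%:R by rewrite lerBlDr ltW.
have s1 : 1 <= s%:R :> R.
  by rewrite ler1n -(ltr0n R); lra.
have s_gt0 : (0 < s)%N by rewrite -(ler1n R).
have [t tLam] : exists t, t * Lam = x * w by exists (x * w / Lam); rewrite divfK ?gt_eqF.
have t18 : 18 <= t.
  rewrite -(ler_pM2r Lam0) tLam.
  have : 18 * (Lam / C) * x <= w * x by rewrite ler_wpM2r // ltW.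
  have : Lam / C * C <= Lam / C * x by rewrite ler_wpM2l // divr_ge0 // ltW.
  rewrite divfK ?gt_eqF //; lra.
have t23 : 0 <= 2 / 3 * t by lra.
have [l l_le l_gt] := nat_floor t23.
have lKw : l%:R <= K * w.
  apply: le_trans l_le _; rewrite -(ler_pM2r Lam0).
  have -> : K * w * Lam = 2 / 3 * (X * w) by rewrite mulrAC KLam mulrA.
  have : x * w <= X * w by apply: ler_wpM2r => //; lra.
  rewrite -tLam; lra.
have zs0 : 0 <= (1 - v - eps) * s%:R by rewrite mulr_ge0 //; lra.
have [z z_le z_gt] := nat_floor zs0.
have lezs : (z <= s)%N.
  rewrite -(ler_nat R); apply: le_trans z_le _.
  by apply: ler_piMl => //; lra.
have lns : ln s%:R <= w by rewrite -[w]expRK expw ler_ln ?posrE; lra.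
have lns0 : 0 <= ln s%:R :> R by exact: ln_ge0.
have [h hE] : exists h, h = 5 / 6 * w by exists (5 / 6 * w).
have lnh0 : 0 <= l%:R * ln s%:R * expR h by rewrite !mulr_ge0 // expR_ge0.
have [m' m'_le m'_gt] := nat_floor lnh0.
have [m mE] : exists m, m = m'.+2 by exists m'.+2.
have mRE : m%:R = m'%:R + 2 :> R by rewrite mE -addn2 natrD.
have m_gt : l%:R * ln s%:R * expR h < m%:R by lra.
have m_le : m%:R <= K * w * w * expR h + 2.
  rewrite mRE lerD2r; apply: le_trans m'_le _.
  by apply: ler_wpM2r; rewrite ?expR_ge0 //; apply: ler_pM.
have lemz : (m + l <= z)%N.
  rewrite -ltnS -(ltr_nat R) -natr1 natrD.
  have : q0 / 2 * (y / 2 - 1) <= (1 - v - eps) * s%:R by exact: ler_pM.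
  move: E1; rewrite -hE; lra.
have rate : expR (- (5 / 4 * (Lam / x))) <= (z - l)%:R / s%:R.
  apply: le_trans rate_x _.
  rewrite vE ler_pdivlMr ?ltr0n // natrB ?(leq_trans _ lemz) ?leq_addl //.
  have : eps * (y / 2 - 1) <= eps * s%:R by apply: ler_wpM2l => //; exact: ltW.
  lra.
(* This is where the factors [5 / 4] and [2 / 3] combine to [5 / 6]. *)
have rate_l : 5 / 4 * (Lam / x) * l%:R <= h.
  apply: le_trans (_ : 5 / 4 * (Lam / x) * (2 / 3 * t) <= _).
    apply: ler_wpM2l => //; apply: mulr_ge0; first lra.
    by apply: divr_ge0; apply: ltW.
  have -> : 5 / 4 * (Lam / x) * (2 / 3 * t) = 5 / 6 * (t * Lam * x^-1) by field; rewrite gt_eqF.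
  by rewrite tLam vE [x * w * v]mulrAC xv mul1r hE.
have small := failure_lt1 s_gt0 lezs rate rate_l m_gt.
have [P PE] : exists P, P = (m + m * 2 ^ s * (m + l).+1)%N by eexists.
have P_le : P%:R + s%:R <= eps / 4 * N.
  rewrite PE; apply: le_trans (overhead_bound s_gt0 (leq_trans lemz lezs) s_le) _.
  have -> : N = expR (y / 2) * expR (y / 2) by rewrite -expRD -splitr.
  by rewrite mulrA; apply: ler_wpM2r; rewrite ?expR_ge0.
have kPn : (k.+1 + P <= n)%N.
  rewrite -(ler_nat R) natrD NE -xN.
  have : C * N <= x * N by apply: ler_wpM2r => //; apply: ltW.
  have : eps * N <= (C - 1) / 2 * N by apply: ler_wpM2r => //; apply: ltW.
  have : 0 <= eps * N by apply: mulr_ge0; apply: ltW.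
  have : 0 <= s%:R :> R by [].
  lra.
exists l; last first.
  have -> : x * w / (2 * Lam) = t / 2 by rewrite -tLam; field; rewrite gt_eqF.
  lra.
have -> : n = (n - P + P)%N by rewrite subnK // (leq_trans (leq_addl _ _) kPn).
rewrite [X in (_ + X)%N]PE; apply: (gap_from_design (R := R) (z := z)) => //.
- apply/andP; split; last by rewrite ltn_subRL addnC.
  have : 1 < N by rewrite -expy expR_gt1; lra.
  by rewrite -NE ltr1n ltnS.
- by rewrite mE.
have x1 : 1 <= x := le_trans (ltW C1) Cx.
apply: (enough_neighbors (v := v) (eps := eps) (N := N) (x := x)) => //.
- by rewrite ltW.
- by rewrite ltW //; lra.
- exact: ltW.
- by rewrite -NE ler_nat.
rewrite natrB ?(leq_trans _ kPn) ?leq_addl // xN; lra.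
Qed.

Lemma gadget_asymptotic (k n : nat) :
  threshold <= ln (ln k.+1%:R) ->
  C * k.+1%:R <= n%:R <= X * k.+1%:R ->
  exists2 l, gap_reached n k l
    & Phi C / 2 * (n%:R / k.+1%:R) * ln (ln k.+1%:R) + 2 <= l%:R.
Proof.
move=> lew /andP[CN nX]; have [_ w19] := threshold_bounds lew.
have N0 : 0 < k.+1%:R :> R by rewrite ltr0n.
have lnN0 : 0 < ln k.+1%:R :> R.
  by rewrite ltNge; apply/negP => /ln0 y0; move: w19; rewrite y0; lra.
have xN : n%:R / k.+1%:R * k.+1%:R = n%:R :> R by rewrite divfK // gt_eqF.
have eN : expR (ln k.+1%:R) = k.+1%:R :> R by rewrite lnK.
have elnN : expR (ln (ln k.+1%:R)) = ln k.+1%:R :> R by rewrite lnK.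
have xCX : C <= n%:R / k.+1%:R <= X by rewrite ler_pdivlMr // ler_pdivrMr // CN.
have [l gap lel] := gadget_asymptotic_exp elnN eN xN xCX lew.
exists l => //; apply: le_trans lel; rewrite lerD2r /Phi -/Lam.
by rewrite le_eqVlt; apply/orP; left; apply/eqP; field; rewrite !gt_eqF // Lam_gt0.
Qed.
End Asymptotics.

(** * Bounds for all numbers of vertices *)

(** Pieces of about [C * N] vertices are split off until at most [(2 * C + 1) * N]
    vertices are left.  The summand [2] in the conclusion absorbs the loss in
    gluing, which makes the bound additive. *)
Lemma gap_asymptotic (R : realType) (C : R) (k n : nat) : 1 < C ->
  threshold C (2 * C + 1) <= ln (ln k.+1%:R) -> C * k.+1%:R <= n%:R ->
  exists2 v, gap_reached n k v
    & Phi C / 2 * (n%:R / k.+1%:R) * ln (ln k.+1%:R) + 2 <= v%:R.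
Proof.
move=> C1 lew; set N : R := k.+1%:R; set w := ln (ln N).
have CX : C <= 2 * C + 1 by lra.
have N1 : 1 <= N by rewrite ler1n.
pose n0 := (Num.truncn (C * N)).+1.
have /andP[n0_le n0_gt] : (Num.truncn (C * N))%:R <= C * N < n0%:R.
  by apply: truncn_itv; rewrite mulr_ge0 //; lra.
have n0E : n0%:R <= C * N + 1 by rewrite -natr1 lerD2r.
have n0_gt0 : (0 < n0)%N by [].
have [v0 gap0 lev0] : exists2 v, gap_reached n0 k v
    & Phi C / 2 * (n0%:R / N) * w + 2 <= v%:R.
  by apply: (gadget_asymptotic C1 CX) => //; rewrite ltW //=; move: n0E; nra.
have [b] := ubnP n; elim: b n => // b IH n ltnb Cn.
have [nX|nX] := lerP n%:R ((2 * C + 1) * N).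
  by apply: (gadget_asymptotic C1 CX) => //; rewrite Cn.
have len0 : (n0 <= n)%N by rewrite -(ler_nat R); nra.
have Cn' : C * N <= (n - n0)%:R by rewrite natrB //; nra.
have n'_gt0 : (0 < n - n0)%N.
  by rewrite -(ltr_nat R); apply: lt_le_trans Cn'; rewrite mulr_gt0 //; lra.
have [|v gap lev] := IH (n - n0)%N _ Cn'.
  by apply: leq_trans (ltnb : n <= b)%N; rewrite ltn_subrL n0_gt0 (leq_trans n0_gt0 len0).
have := gap_reached_glue n'_gt0 n0_gt0 gap gap0; rewrite subnK // => gap'.
exists (v + v0 - 2)%N => //.
apply: le_trans (_ : (v + v0)%:R - 2%:R <= _); last first.
  by rewrite lerBlDr -natrD ler_nat [leqRHS]addnC -leq_subLR.
have -> : Phi C / 2 * (n%:R / N) * w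
    = Phi C / 2 * ((n - n0)%:R / N) * w + Phi C / 2 * (n0%:R / N) * w.
  by rewrite -mulrDl -mulrDr -mulrDl -natrD subnK.
move: lev lev0; rewrite (natrD _ v v0).
by move: (Phi C / 2 * _ * w) (Phi C / 2 * _ * w) => a a0; lra.
Qed.

Lemma ln_ln_large (R : realType) (W : R) :
  exists k0 : nat, forall k, (k0 <= k)%N -> W <= ln (ln k.+1%:R).
Proof.
exists (Num.truncn (expR (expR W))).+1 => k lek.
have leN : expR (expR W) <= k.+1%:R.
  have /andP[_ /ltW] := truncn_itv (expR_ge0 (expR W)).
  by move=> /le_trans; apply; rewrite ler_nat leqW.
have leln : expR W <= ln k.+1%:R.
  by rewrite -[leLHS]expRK ler_ln ?posrE ?expR_gt0 ?ltr0n.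
by rewrite -[leLHS]expRK ler_ln ?posrE ?expR_gt0 ?(lt_le_trans (expR_gt0 W)).
Qed.

Theorem corollary1p5 (R : realType) (C : R) (hC : 1 < C) :
  exists k0 : nat, forall k n : nat,
    (k0 <= k)%N -> C * k.+1%:R <= n%:R ->
    Phi C / 2 * (n%:R / k.+1%:R) * ln (ln k.+1%:R) < (M n k)%:R :> R
    /\ (M n k)%:R < 3 / 2 * (n%:R / k.+1%:R) * ln (ln k.+1%:R) :> R.
Proof.
have [k0 large] := ln_ln_large (Num.max 19 (threshold C (2 * C + 1))).
exists k0 => k n /large; rewrite ge_max => /andP[w19 wC] Cn.
split; last first.
  apply: M_upper; last by lra.
  rewrite -(ltr_nat R); apply: lt_le_trans Cn.
  by rewrite mulr_gt0 ?ltr0n // (lt_trans ltr01).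
have [v /gap_reached_M leM lev] := gap_asymptotic hC wC Cn.
by apply: lt_le_trans (le_trans lev _); rewrite ?ltrDl ?ler_nat.
Qed.
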